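(* Let $\mathbf{k}$ be a field of characteristic $0$, $a\in\mathbf{k}^n$, $x=(x_1,\dots,x_n)$, $s=(s_1,\dots,s_p)$. Let $\Upsilon$ be an ideal of $\mathbf{k}[x,s]$ and let $\Upsilon=\Upsilon_1\cap\cdots\cap\Upsilon_r$ be a primary decomposition of $\Upsilon$. Let $\sigma_a\subset\{1,\dots,r\}$ be defined by $i\in\sigma_a\iff a\in V(\Upsilon_i\cap\mathbf{k}[x])$. Then: - if $\sigma_a=\emptyset$, then $(\mathbf{k}[x]_a[s]\cdot\Upsilon)\cap\mathbf{k}[s]=\mathbf{k}[s]$; - otherwise, $(\mathbf{k}[x]_a[s]\cdot\Upsilon)\cap\mathbf{k}[s]=\bigl(\bigcap_{i\in\sigma_a}\Upsilon_i\bigr)\cap\mathbf{k}[s]$.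
   Context: $\mathbf{k}[x]_a$ denotes the localization of $\mathbf{k}[x]$ at the point $a$ (fractions whose denominators do not vanish at $a$). For an ideal $K\subset\mathbf{k}[x]$, $V(K)\subset\mathbf{k}^n$ denotes its zero set. *)

(* Defs.v *)
From mathcomp Require Export all_boot all_order all_algebra fraction.
From mathcomp Require Export mpoly.
From mathcomp Require Export classical_sets.

Set Implicit Arguments.
Unset Strict Implicit.
Unset Printing Implicit Defensive.

Import GRing.Theory.

Local Open Scope ring_scope.
Local Open Scope classical_set_scope.

Local Notation "x %:F" := (tofrac x) (at level 1, format "x %:F").

(* Unlike MathComp's [idealr_closed], this is neither restricted to decidable
   subsets nor to proper ideals. *)
Definition is_ideal (R : comNzRingType) (I : set R) : Prop :=
  [/\ I 0, (forall u v, I u -> I v -> I (u + v))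
         & (forall c u, I u -> I (c * u))].

(* Primary ideals are proper, as usual. *)
Definition is_primary (R : comNzRingType) (I : set R) : Prop :=
  [/\ is_ideal I, ~ I 1
    & forall u v, I (u * v) -> I u \/ exists e : nat, I (v ^+ e)].

(* No minimality is required; for r = 0 the intersection is the whole ring. *)
Definition is_primary_decomposition (R : comNzRingType) (r : nat)
    (I : set R) (Q : 'I_r -> set R) : Prop :=
  (forall i, is_primary (Q i)) /\ I = \bigcap_i Q i.

(* B . G, for a subring B and a subset G of R: the B-linear combinations of
   elements of G. *)
Definition gen_ideal (R : comNzRingType) (B G : set R) : set R :=
  [set f | exists (m : nat) (c g : 'I_m -> R),
     [/\ (forall j, B (c j)), (forall j, G (g j))
       & f = \sum_(j < m) c j * g j]].

Section Polynomials.

Variables (k : fieldType) (n p : nat).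

(* k[x, s] is {mpoly k[n + p]}: the first n variables are x, the last p are s.
   The inclusions of k[x], k[s] into k[x, s]: *)
Definition incl_x (f : {mpoly k[n]}) : {mpoly k[n + p]} :=
  f \mPo [tuple 'X_(lshift p i) | i < n].

Definition incl_s (f : {mpoly k[p]}) : {mpoly k[n + p]} :=
  f \mPo [tuple 'X_(rshift n j) | j < p].

Definition zero_set (I : set {mpoly k[n]}) : set ('I_n -> k) :=
  [set a | forall f, I f -> f.@[a] = 0].

(* k(x)[s], a common overring of k[x, s] and of k[x]_a[s]. *)
Definition ratx_s : comNzRingType := {mpoly {fraction {mpoly k[n]}}[p]}.

Definition incl_xs (f : {mpoly k[n + p]}) : ratx_s :=
  mmap (@mpolyC p {fraction {mpoly k[n]}} \o @tofrac {mpoly k[n]} \o @mpolyC n k)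
       (fun i => match split i with
                 | inl i => (('X_i : {mpoly k[n]})%:F)%:MP
                 | inr j => 'X_j
                 end) f.

(* k[x]_a, as a subring of k(x). *)
Definition localization (a : 'I_n -> k) : set {fraction {mpoly k[n]}} :=
  [set f | exists u v : {mpoly k[n]}, v.@[a] != 0 /\ f = u%:F / v%:F].

(* k[x]_a[s], as a subring of k(x)[s]. *)
Definition localization_s (a : 'I_n -> k) : set ratx_s :=
  [set P : {mpoly {fraction {mpoly k[n]}}[p]} |
    forall m : 'X_{1..p}, localization a P@_m].

(* The ideal k[x]_a[s] . Y of k[x]_a[s]. *)
Definition ext_ideal (a : 'I_n -> k) (Y : set {mpoly k[n + p]}) : set ratx_s :=
  gen_ideal (localization_s a) (incl_xs @` Y).

(* Intersections with k[x] and k[s] are preimages under the inclusions. *)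
Definition cap_kx (Y : set {mpoly k[n + p]}) : set {mpoly k[n]} :=
  incl_x @^-1` Y.

Definition cap_ks (Y : set {mpoly k[n + p]}) : set {mpoly k[p]} :=
  incl_s @^-1` Y.

Definition ext_cap_ks (J : set ratx_s) : set {mpoly k[p]} :=
  (fun f => incl_xs (incl_s f)) @^-1` J.

Definition sigma (r : nat) (a : 'I_n -> k) (Q : 'I_r -> set {mpoly k[n + p]}) :
    set 'I_r :=
  [set i | zero_set (cap_kx (Q i)) a].

End Polynomials.

(* Main.v *)
From HB Require Import structures.
From mathcomp Require Import boolp.
Require Import Defs.
Local Open Scope ring_scope.
Local Open Scope classical_set_scope.

Set Implicit Arguments.
Unset Strict Implicit.
Unset Printing Implicit Defensive.

Import GRing.Theory.

(* A polynomial f in k[s] lies in the extension of Y to k[x]_a[s] iff v f lies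
   in Y for some v in k[x] with v(a) <> 0: clear denominators.  If a is in
   V(Q_i /\ k[x]), no power of such a v lies in Q_i, so v f in Q_i forces f in
   Q_i by primariness.  Conversely, each of the finitely many other Q_i contains
   an element of k[x] not vanishing at a, and the product of these elements
   multiplies the intersection of the remaining components into Y. *)

Lemma mpoly_rmorph_ext (R S : nzRingType) (n : nat)
    (f g : {rmorphism {mpoly R[n]} -> S}) :
  (forall c, f c%:MP = g c%:MP) -> (forall i, f 'X_i = g 'X_i) -> f =1 g.
Proof.
move=> eqC eqX q; rewrite [q]mpolyE !rmorph_sum; apply: eq_bigr => m _.
rewrite -mul_mpolyC !rmorphM eqC; congr (_ * _).
rewrite mpolyXE_id !rmorph_prod; apply: eq_bigr => i _.
by rewrite !rmorphXn eqX.
Qed.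

Lemma tofrac_inj (R : idomainType) : injective (@tofrac R).
Proof. by move=> u v /eqP; rewrite tofrac_eq => /eqP. Qed.

Lemma map_mpoly_inj (R S : nzRingType) (n : nat) (f : {rmorphism R -> S}) :
  injective f -> injective (@map_mpoly n R S f).
Proof.
move=> f_inj u v /mpolyP uv; apply/mpolyP => m.
by apply: f_inj; rewrite -!mcoeff_map_mpoly.
Qed.

(** * The embeddings of k[x], k[s] and k[x,s] as ring morphisms *)

Section Inclusions.

Variables (k : fieldType) (n p : nat).

HB.instance Definition _ := GRing.RMorphism.copy (@incl_x k n p)
  (@comp_mpoly n k (n + p) [tuple 'X_(lshift p i) | i < n]).

HB.instance Definition _ := GRing.RMorphism.copy (@incl_s k n p)
  (@comp_mpoly p k (n + p) [tuple 'X_(rshift n j) | j < p]).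

HB.instance Definition _ := GRing.RMorphism.copy (@incl_xs k n p)
  (mmap (@mpolyC p {fraction {mpoly k[n]}} \o @tofrac {mpoly k[n]} \o @mpolyC n k)
       (fun i => match split i with
                 | inl i => (tofrac ('X_i : {mpoly k[n]}))%:MP
                 | inr j => 'X_j
                 end)).

Lemma incl_xM : {morph @incl_x k n p : u v / u * v}.
Proof. exact: rmorphM. Qed.

Lemma incl_xsD : {morph @incl_xs k n p : u v / u + v}.
Proof. exact: rmorphD. Qed.

Lemma incl_xsM : {morph @incl_xs k n p : u v / u * v}.
Proof. exact: rmorphM. Qed.

Lemma incl_xC c : @incl_x k n p c%:MP = c%:MP.
Proof. exact: comp_mpolyC. Qed.

Lemma incl_xX i : @incl_x k n p 'X_i = 'X_(lshift p i).
Proof. by rewrite /incl_x comp_mpolyXU -tnth_nth tnth_mktuple. Qed.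

Lemma incl_sX j : @incl_s k n p 'X_j = 'X_(rshift n j).
Proof. by rewrite /incl_s comp_mpolyXU -tnth_nth tnth_mktuple. Qed.

Lemma incl_xsC c : @incl_xs k n p c%:MP = (tofrac c%:MP)%:MP.
Proof. by rewrite /incl_xs mmapC. Qed.

Lemma incl_xsXl i : @incl_xs k n p 'X_(lshift p i) = (tofrac 'X_i)%:MP.
Proof. by rewrite /incl_xs mmapX mmap1U (unsplitK (inl i)). Qed.

Lemma incl_xsXr j : @incl_xs k n p 'X_(rshift n j) = 'X_j.
Proof. by rewrite /incl_xs mmapX mmap1U (unsplitK (inr j)). Qed.

Lemma incl_xs_x (v : {mpoly k[n]}) :
  incl_xs (@incl_x k n p v) = (tofrac v)%:MP.
Proof.
pose g : {rmorphism {mpoly k[n]} -> {mpoly {fraction {mpoly k[n]}}[p]}} :=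
  @mpolyC p {fraction {mpoly k[n]}} \o @tofrac {mpoly k[n]}.
pose f : {rmorphism {mpoly k[n]} -> ratx_s k n p} :=
  @incl_xs k n p \o @incl_x k n p.
apply: (@mpoly_rmorph_ext _ _ _ f g) => [c|i] /=.
  by rewrite incl_xC incl_xsC.
by rewrite incl_xX incl_xsXl.
Qed.

Lemma incl_xs_s (m : 'X_{1..p}) :
  incl_xs (@incl_s k n p 'X_[m]) = 'X_[m].
Proof.
rewrite mpolyXE_id !rmorph_prod [RHS]mpolyXE_id; apply: eq_bigr => j _.
by rewrite !rmorphXn /= incl_sX incl_xsXr.
Qed.

(** [incl_xs] factors as [phi], which regroups k[x,s] as k[x][s] and has left inverse [psi],
    followed by the coefficientwise embedding of k[x] into its fraction field. Both are
    injective. *)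
Lemma incl_xs_inj : injective (@incl_xs k n p).
Proof.
pose h i : {mpoly {mpoly k[n]}[p]} :=
  match split i with inl i => ('X_i)%:MP | inr j => 'X_j end.
pose phi : {rmorphism {mpoly k[n + p]} -> {mpoly {mpoly k[n]}[p]}} :=
  mmap (@mpolyC p {mpoly k[n]} \o @mpolyC n k) h.
pose psi : {rmorphism {mpoly {mpoly k[n]}[p]} -> {mpoly k[n + p]}} :=
  mmap (@incl_x k n p) (fun j => 'X_(rshift n j)).
have phiK : cancel phi psi.
  pose f : {rmorphism {mpoly k[n + p]} -> {mpoly k[n + p]}} := psi \o phi.
  pose g : {rmorphism {mpoly k[n + p]} -> {mpoly k[n + p]}} := idfun.
  apply: (@mpoly_rmorph_ext _ _ _ f g) => [c|i] /=.
    by rewrite mmapC /= mmapC /= incl_xC.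
  rewrite mmapX mmap1U /h; case: splitP => j ij.
    by rewrite mmapC /= incl_xX; congr 'X_ _; apply: val_inj.
  by rewrite mmapX mmap1U; congr 'X_ _; apply: val_inj.
pose mf : {rmorphism {mpoly {mpoly k[n]}[p]} -> ratx_s k n p} :=
  map_mpoly (@tofrac {mpoly k[n]}).
have xsE : @incl_xs k n p =1 mf \o phi.
  pose f : {rmorphism {mpoly k[n + p]} -> ratx_s k n p} := @incl_xs k n p.
  pose g : {rmorphism {mpoly k[n + p]} -> ratx_s k n p} := mf \o phi.
  apply: (@mpoly_rmorph_ext _ _ _ f g) => [c|i] /=.
    by rewrite incl_xsC mmapC map_mpolyC.
  rewrite /incl_xs !mmapX !mmap1U /h; case: (split i) => j.
    by rewrite map_mpolyC.
  by rewrite map_mpolyX.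
move=> u v uv; apply: (can_inj phiK).
apply: (map_mpoly_inj (f := @tofrac {mpoly k[n]}) (@tofrac_inj _)).
by rewrite !xsE in uv.
Qed.

End Inclusions.

(** * Clearing denominators in the extended ideal *)

Section Extension.

Variables (k : fieldType) (n p : nat) (a : 'I_n -> k).
Variables (Y : set {mpoly k[n + p]}) (hY : is_ideal Y).

Let cleared (c : ratx_s k n p) := exists (v : {mpoly k[n]}) w,
  [/\ v.@[a] != 0, Y w & incl_xs (incl_x p v) * c = incl_xs w].

Let clearedD c d : cleared c -> cleared d -> cleared (c + d).
Proof.
have [_ YD YM] := hY.
move=> [v1 [w1 [nz1 Y1 e1]]] [v2 [w2 [nz2 Y2 e2]]].
(* Common denominator, with cross-multiplied numerators. *)
exists (v1 * v2), (incl_x p v2 * w1 + incl_x p v1 * w2); split.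
- by rewrite mevalM mulf_neq0.
- by apply: YD; apply: YM.
rewrite incl_xM incl_xsD !incl_xsM -e1 -e2.
move: (incl_xs _) (incl_xs _) => A1 A2.
by rewrite mulrDr !mulrA [A1 * A2]mulrC.
Qed.

Let cleared_sum (J : Type) (s : seq J) (F : J -> ratx_s k n p) :
  (forall j, cleared (F j)) -> cleared (\sum_(j <- s) F j).
Proof.
have [Y0 _ _] := hY.
move=> FP; elim/big_ind: _ => //.
by exists 1, 0; split; rewrite ?meval1 ?oner_neq0 // mulr0 rmorph0.
Qed.

(** Since [cleared] is stable under finite sums, it suffices to treat a single product of a term
    (u/v) s^e of a coefficient with a generator w. *)
Lemma ext_ideal_clear_denominators c : ext_ideal a Y c ->
  exists (v : {mpoly k[n]}) w,
    [/\ v.@[a] != 0, Y w & incl_xs (incl_x p v) * c = incl_xs w].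
Proof.
have [_ _ YM] := hY.
move=> [m [d [g [dP gP ->]]]]; apply: cleared_sum => j.
have [w Yw <-] := gP j.
rewrite [d j]mpolyE mulr_suml; apply: cleared_sum => e.
have [u [v [nzv ->]]] := dP j e.
have nzF : tofrac v != 0.
  by rewrite tofrac_eq0; apply: contraNneq nzv => ->; rewrite meval0.
(* Multiplying by v turns (u/v) s^e w into u s^e w, which stays in [Y] with w. *)
exists v, (incl_x p u * incl_s n 'X_[e] * w); split=> //; first exact: YM.
rewrite !incl_xsM !incl_xs_x incl_xs_s -mul_mpolyC !mulrA -mpolyCM.
by rewrite mulrCA divff ?mulr1.
Qed.

Lemma ext_cap_ksP f : ext_cap_ks (ext_ideal a Y) f <->
  exists v : {mpoly k[n]}, v.@[a] != 0 /\ Y (incl_x p v * incl_s n f).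
Proof.
split.
  move=> /ext_ideal_clear_denominators [v [w [nzv Yw e]]]; exists v; split=> //.
  suff -> : incl_x p v * incl_s n f = w by [].
  by apply: incl_xs_inj; rewrite incl_xsM.
move=> [v [nzv Yvf]].
have nzF : tofrac v != 0.
  by rewrite tofrac_eq0; apply: contraNneq nzv => ->; rewrite meval0.
(* One-term combination: f = (1/v) (v f). *)
exists 1, (fun=> ((tofrac v)^-1)%:MP), (fun=> incl_xs (incl_x p v * incl_s n f)).
split=> [_ m|_|].
- rewrite mcoeffC; case: (_ == _).
    by exists 1, v; rewrite mulr1 rmorph1 mul1r.
  by exists 0, 1; rewrite meval1 oner_neq0 mulr0 rmorph0 mul0r.
- by exists (incl_x p v * incl_s n f).
by rewrite big_ord1 incl_xsM incl_xs_x mulrA -mpolyCM mulVf // mpolyC1 mul1r.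
Qed.

End Extension.

(** * Primary components through the point a and away from it *)

Lemma nonvanishing_outside_sigma (k : fieldType) (n p r : nat) (a : 'I_n -> k)
    (Q : 'I_r -> set {mpoly k[n + p]}) :
  (forall i, is_ideal (Q i)) ->
  exists v : {mpoly k[n]},
    v.@[a] != 0 /\ forall i, ~ sigma a Q i -> Q i (incl_x p v).
Proof.
move=> idQ.
have /fin_all_exists[v vP] i : exists v : {mpoly k[n]},
    v.@[a] != 0 /\ (~ sigma a Q i -> Q i (incl_x p v)).
  have [si|nsi] := pselect (sigma a Q i).
    (* Neutral factor, so that the product below can run over all indices. *)
    by exists 1; rewrite meval1 oner_neq0.
  have /existsNP[v /not_implyP[Qv /eqP nzv]] := nsi.
  by exists v.
exists (\prod_i v i); split.
  by rewrite rmorph_prod; apply/prodf_neq0 => i _; case: (vP i).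
move=> i nsi; have [_ _ QM] := idQ i.
rewrite (bigD1 i) //= mulrC incl_xM; apply: QM.
by case: (vP i) => _; apply.
Qed.

(** Covers both cases of the theorem: an intersection over an empty [sigma a Q] is the whole
    ring. *)
Lemma ext_cap_ks_sigma (k : fieldType) (n p : nat) (a : 'I_n -> k)
    (Y : set {mpoly k[n + p]}) (r : nat) (Q : 'I_r -> set {mpoly k[n + p]}) :
  is_ideal Y -> is_primary_decomposition Y Q ->
  ext_cap_ks (ext_ideal a Y) = cap_ks (\bigcap_(i in sigma a Q) Q i).
Proof.
move=> hY [primQ YE]; apply/seteqP; split=> f.
  move=> /(ext_cap_ksP a hY)[v [nzv]]; rewrite YE => Yvf i si.
  have [_ _ primQi] := primQ i.
  (* With f as first factor, primariness leaves either f or a power of v in [Q i]. *)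
  have := Yvf i I; rewrite mulrC => /primQi[//|[e Qe]].
  (* The power of v would vanish at a, impossible for every e, including e = 0. *)
  have : (v ^+ e).@[a] = 0 by apply: si; rewrite /cap_kx /= rmorphXn.
  by move/eqP; rewrite rmorphXn expf_eq0 (negbTE nzv) andbF.
move=> Qf; apply/(ext_cap_ksP a hY).
have idQ i : is_ideal (Q i) by case: (primQ i).
have [v [nzv Qv]] := nonvanishing_outside_sigma a idQ.
exists v; split=> //; rewrite YE => i _; have [_ _ QM] := idQ i.
(* The product v f lies in [Q i] thanks to f when i is in [sigma a Q], and thanks to v otherwise. *)
have [si|nsi] := pselect (sigma a Q i); first exact: QM (Qf i si).
by rewrite mulrC; apply: QM; apply: Qv.
Qed.

Theorem proposition1p4 (k : fieldType) (hk : [pchar k] =i pred0)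
    (n p : nat) (a : 'I_n -> k)
    (Y : set {mpoly k[n + p]}) (hY : is_ideal Y)
    (r : nat) (Q : 'I_r -> set {mpoly k[n + p]})
    (hQ : is_primary_decomposition Y Q) :
  (sigma a Q = set0 -> ext_cap_ks (ext_ideal a Y) = setT) /\
  (sigma a Q <> set0 ->
     ext_cap_ks (ext_ideal a Y) = cap_ks (\bigcap_(i in sigma a Q) Q i)).
Proof.
rewrite (ext_cap_ks_sigma a hY hQ); split=> // ->.
by rewrite bigcap_set0.
Qed.
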